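(* For $\beta,\gamma>-1$ and integers $m\ge n\ge0$, writing $M_{m,n}$ for $M^{(\beta,\gamma)}_{m,n}(z_1,z_2|q)$, $$\frac{1-q^{\beta+\gamma+m+n+2}}{q^n(1-q^{\beta+m-n+1})}\,z_2\,M_{m+1,n}=-M_{m+1,n+1}+M_{m,n},$$ $$z_1M_{m,n}=\frac{(1-q^{\beta+m+1})(1-q^{\beta+\gamma+m+1})}{(1-q^{\beta+m-n+1})(1-q^{\beta+\gamma+m+n+1})}\,M_{m+1,n}-\frac{q^{m-n+\beta+1}(1-q^n)(1-q^{\gamma+n})}{(1-q^{\beta+m-n+1})(1-q^{\beta+\gamma+m+n+1})}\,M_{m,n-1}.$$
   Context: $0<q<1$; $(a;q)_n=\prod_{k=0}^{n-1}(1-aq^k)$, $(a,b;q)_n=(a;q)_n(b;q)_n$. The little $q$-Jacobi polynomials are $$p_n(x;q^\alpha,q^\gamma|q)=\frac{(q;q)_n}{q^{\binom n2}}\sum_{k=0}^n\frac{(q^{\alpha+\gamma+n+1};q)_{n-k}\,q^{\binom k2}(-x)^{n-k}}{(q;q)_k(q,q^{\alpha+1};q)_{n-k}}.$$ For $\beta,\gamma>-1$, $M^{(\beta,\gamma)}_{m,n}(z_1,z_2|q)=z_1^{m-n}p_n(z_1z_2;q^{\beta+m-n},q^\gamma|q)$ if $m\ge n$, and $M^{(\beta,\gamma)}_{m,n}(z_1,z_2|q)=M^{(\beta,\gamma)}_{n,m}(z_2,z_1|q)$ if $m<n$; terms with a negative index are $0$. Coefficients in the second identity are read by continuity if a factor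 $1-q^{\beta+\gamma+m+n+1}$ in numerator and denominator vanishes simultaneously. *)

(* Defs.v *)
From HB Require Import structures.
From mathcomp Require Import all_boot all_order all_algebra.
From mathcomp Require Import all_classical all_reals all_analysis.
From mathcomp Require Export complex.
Import Order.TTheory GRing.Theory Num.Theory.
Import numFieldNormedType.Exports.

Set Implicit Arguments.
Unset Strict Implicit.
Unset Printing Implicit Defensive.

Local Open Scope classical_set_scope.
Local Open Scope ring_scope.
Local Open Scope complex_scope.

(* (a; q)_n *)
Definition qpoch {R : realType} (a q : R) (n : nat) : R :=
  \prod_(k < n) (1 - a * q ^+ k).

(* p_n(x; q^alpha, q^gamma | q); the arguments are the exponents alpha, gamma *)
Definition little_qjacobi {R : realType} (q alpha gamma : R) (n : nat)
    (x : R[i]) : R[i] :=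
  (qpoch q q n / q ^+ 'C(n, 2))%:C *
  \sum_(k < n.+1)
    ((qpoch (q `^ (alpha + gamma + n%:R + 1)) q (n - k) * q ^+ 'C(k, 2)) /
     (qpoch q q k *
      (qpoch q q (n - k) * qpoch (q `^ (alpha + 1)) q (n - k))))%:C
    * (- x) ^+ (n - k).

(* the case m >= n of M_{m,n} *)
Definition qdisk_ge {R : realType} (q beta gamma : R) (m n : nat)
    (z1 z2 : R[i]) : R[i] :=
  z1 ^+ (m - n) * little_qjacobi q (beta + (m - n)%:R) gamma n (z1 * z2).

(* M_{m,n}^{(beta,gamma)}(z1, z2 | q), with value 0 at negative indices *)
Definition qdisk {R : realType} (q beta gamma : R) (m n : int)
    (z1 z2 : R[i]) : R[i] :=
  match m, n with
  | Posz m, Posz n =>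
      if (n <= m)%N then qdisk_ge q beta gamma m n z1 z2
      else qdisk_ge q beta gamma n m z2 z1
  | _, _ => 0
  end.

(* The quotient num / den at x, extended by its limit where den vanishes *)
Definition quot_by_continuity {R : realType} (num den : R -> R) (x : R) : R :=
  if den x == 0 then lim (num y / den y @[y --> x^']) else num x / den x.

(* In both coefficients below the limit is taken in gamma, beta being fixed.
   For beta, gamma > -1 and m >= n it is used only if m = n = 0 and
   beta + gamma = -1. *)
Definition rec_den {R : realType} (q beta : R) (m n : nat) (gamma : R) : R :=
  (1 - q `^ (beta + m%:R - n%:R + 1)) *
  (1 - q `^ (beta + gamma + m%:R + n%:R + 1)).

Definition rec_up {R : realType} (q beta gamma : R) (m n : nat) : R :=
  quot_by_continuity
    (fun g => (1 - q `^ (beta + m%:R + 1)) * (1 - q `^ (beta + g + m%:R + 1)))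
    (rec_den q beta m n) gamma.

Definition rec_down {R : realType} (q beta gamma : R) (m n : nat) : R :=
  quot_by_continuity
    (fun g => q `^ (m%:R - n%:R + beta + 1) * (1 - q ^+ n) *
              (1 - q `^ (g + n%:R)))
    (rec_den q beta m n) gamma.

(* Main.v *)
Require Import Defs.
From mathcomp Require Import all_boot all_order all_algebra.
From mathcomp Require Import all_classical all_reals all_analysis.
From mathcomp Require Import ring lra zify.
Import Order.TTheory GRing.Theory Num.Theory.
Import numFieldNormedType.Exports.
Local Open Scope ring_scope.
Local Open Scope complex_scope.

(** In the variables [A = q^-n], [B = q^(beta+gamma+m+1)] and
    [C = q^(beta+m-n+1)], the polynomial [M_{m,n}] with [m >= n] is
    [z1^(m-n)] times the basic hypergeometric series
    [phi(A, B; C) = sum_j (A;q)_j (B;q)_j / ((q;q)_j (C;q)_j) (q x)^j] at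
    [x = z1 z2] ([qdisk_phi]).  Shifting [m] or [n] by one multiplies [A], [B]
    and [C] by powers of [q], so that, for a common [(A, B, C)], both recurrences
    become contiguous relations of this series:
    - [phi(qA, B; C) - phi(A, qB; C)
         = q x (A - B) / (1 - C) phi(qA, qB; qC)], in which [A] is [q^-(n+1)];
    - [(1 - C)(A - B) phi(A, B; C)
         = (A - C)(1 - B) phi(A, qB; qC) - (B - C)(1 - A) phi(qA, B; qC)].

    Each of them holds coefficient by coefficient ([phi_coef_lower],
    [phi_coef_upper]).  After the common Pochhammer symbols are cancelled, with
    [t = q^(j+1)] in the first relation and [t = q^j] in the second, what remains
    are the polynomial identities
    [(1 - A t)(1 - B) - (1 - A)(1 - B t) = (A - B)(1 - t)] and
    [(A - B)(1 - C t) = (A - C)(1 - B t) - (B - C)(1 - A t)].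

    The case of coefficients defined by a limit arises only for [n = 0].  There
    [rec_up] is a quotient of two equal functions, hence [1] ([rec_up0]), and the
    second recurrence reads [z1 * z1^m = z1^(m+1)]. *)

(** * q-Pochhammer symbols *)

Lemma qpochS (R : realType) (a q : R) n :
  qpoch a q n.+1 = qpoch a q n * (1 - a * q ^+ n).
Proof. by rewrite /qpoch big_ord_recr. Qed.

Lemma qpochSl (R : realType) (a q : R) n :
  qpoch a q n.+1 = (1 - a) * qpoch (q * a) q n.
Proof.
rewrite /qpoch big_ord_recl expr0 mulr1; congr (_ * _).
by apply: eq_bigr => i _; rewrite /= exprS mulrA [a * q]mulrC.
Qed.

Lemma qpoch_shift (R : realType) (a q : R) n :
  (1 - a) * qpoch (q * a) q n = qpoch a q n * (1 - a * q ^+ n).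
Proof. by rewrite -qpochSl qpochS. Qed.

Lemma qpoch_neq0 (R : realType) (a q : R) n :
  0 <= q -> q <= 1 -> 0 <= a -> a < 1 -> qpoch a q n != 0.
Proof.
move=> q0 q1 a0 a1; apply/prodf_neq0 => k _.
by rewrite subr_eq0 eq_sym lt_eqF // (le_lt_trans _ a1) // ler_piMr // exprn_ile1.
Qed.

Lemma qpoch_qVn_eq0 (R : realType) (q : R) n j :
  q != 0 -> (n < j)%N -> qpoch (q ^- n) q j = 0.
Proof.
move=> q0 nj; rewrite /qpoch (bigD1 (Ordinal nj)) //= mulVf ?expf_neq0 //.
by rewrite subrr mul0r.
Qed.

(** * Contiguous relations of the basic hypergeometric series *)

Definition phi_coef {R : realType} (q A B C : R) (j : nat) : R :=
  qpoch A q j * qpoch B q j / (qpoch q q j * qpoch C q j) * q ^+ j.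

(** For [A = q^-n] the coefficients beyond [j = n] vanish, and the truncation is
    the terminating series 2phi1(A, B; C; q, q x) as soon as [n < N].  Leaving
    [N] free lets series of different degrees be summed over the same range. *)
Definition phi_trunc {R : realType} (q A B C : R) (N : nat) (x : R[i]) : R[i] :=
  \sum_(j < N) (phi_coef q A B C j)%:C * x ^+ j.

Lemma phi_coef0 (R : realType) (q A B C : R) : phi_coef q A B C 0 = 1.
Proof. by rewrite /phi_coef /qpoch !big_ord0 expr0 !mulr1 divr1. Qed.

(** The difference of the numerators has the factor [1 - q^(j+1)], which cancels
    against [(q;q)_(j+1)]: this accounts for the drop in degree. *)
Lemma phi_coef_lower (R : realType) (q A B C : R) j :
  0 < q -> q < 1 -> 0 <= C -> C < 1 ->
  phi_coef q (q * A) B C j.+1 - phi_coef q A (q * B) C j.+1 =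
  q * (A - B) / (1 - C) * phi_coef q (q * A) (q * B) (q * C) j.
Proof.
move=> q0 q1 C0 C1.
have Qn0 : qpoch q q j.+1 != 0 by apply: qpoch_neq0 => //; exact: ltW.
have Cn0 : qpoch C q j.+1 != 0 by apply: qpoch_neq0 => //; exact: ltW.
rewrite /phi_coef [qpoch (q * A) q j.+1]qpochS [qpoch B q _]qpochSl.
rewrite [qpoch A q _]qpochSl [qpoch (q * B) q j.+1]qpochS.
move: Cn0 Qn0; rewrite [qpoch C q _]qpochSl [qpoch q q j.+1]qpochS !mulf_eq0 !negb_or exprS.
by move=> /andP[? ?] /andP[? ?]; field; apply/and4P; split.
Qed.

(** The prefactors are those for which [(1 - a) (q a;q)_j = (a;q)_j (1 - a q^j)]
    brings every shifted symbol back to the parameters [A], [B], [C]. *)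
Lemma phi_coef_upper (R : realType) (q A B C : R) j :
  0 < q -> q < 1 -> 0 <= C -> C < 1 ->
  (1 - C) * (A - B) * phi_coef q A B C j =
  (A - C) * (1 - B) * phi_coef q A (q * B) (q * C) j
  - (B - C) * (1 - A) * phi_coef q (q * A) B (q * C) j.
Proof.
move=> q0 q1 C0 C1.
have Qn0 : qpoch q q j != 0 by apply: qpoch_neq0 => //; exact: ltW.
have := @qpoch_neq0 R C q j.+1 (ltW q0) (ltW q1) C0 C1.
rewrite qpochSl mulf_eq0 negb_or => /andP[C1n0 qCn0].
have Cn0 : qpoch C q j != 0 by apply: qpoch_neq0 => //; exact: ltW.
have CE : (1 - C) / qpoch C q j = (1 - C * q ^+ j) / qpoch (q * C) q j.
  by apply/eqP; rewrite eqr_div // qpoch_shift mulrC.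
rewrite /phi_coef.
transitivity ((A - B) * ((1 - C) / qpoch C q j)
   * (qpoch A q j * qpoch B q j / qpoch q q j * q ^+ j)).
  by field; apply/andP.
rewrite CE.
transitivity (((A - C) * qpoch A q j * ((1 - B) * qpoch (q * B) q j)
  - (B - C) * qpoch B q j * ((1 - A) * qpoch (q * A) q j))
   / (qpoch q q j * qpoch (q * C) q j) * q ^+ j); last first.
  by field; apply/andP.
by rewrite !qpoch_shift; field; apply/andP.
Qed.

Lemma phi_trunc_lower (R : realType) (q A B C : R) N (x : R[i]) :
  0 < q -> q < 1 -> 0 <= C -> C < 1 ->
  phi_trunc q (q * A) B C N.+1 x - phi_trunc q A (q * B) C N.+1 x =
  (q * (A - B) / (1 - C))%:C * x * phi_trunc q (q * A) (q * B) (q * C) N x.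
Proof.
move=> q0 q1 C0 C1; rewrite /phi_trunc -sumrB big_ord_recl /= !phi_coef0.
rewrite subrr add0r mulr_sumr; apply: eq_bigr => j _ /=.
rewrite -mulrBl -rmorphB /= phi_coef_lower // rmorphM /= exprS; ring.
Qed.

Lemma phi_trunc_upper (R : realType) (q A B C : R) N (x : R[i]) :
  0 < q -> q < 1 -> 0 <= C -> C < 1 ->
  ((1 - C) * (A - B))%:C * phi_trunc q A B C N x =
  ((A - C) * (1 - B))%:C * phi_trunc q A (q * B) (q * C) N x
  - ((B - C) * (1 - A))%:C * phi_trunc q (q * A) B (q * C) N x.
Proof.
move=> q0 q1 C0 C1; rewrite /phi_trunc !mulr_sumr -sumrB.
apply: eq_bigr => j _; rewrite !mulrA -mulrBl -!rmorphM /= -rmorphB /=.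
by rewrite phi_coef_upper.
Qed.

(** * Hypergeometric form of the polynomials *)

(** The left-hand side is the product over [i < j] of
    [(1 - q^(n-i)) / q^(n-1-i) = - q (1 - q^(i-n))].  The identity converts
    the summands of [little_qjacobi] into those of a hypergeometric series. *)
Lemma qpoch_qVn (R : realType) (q : R) n j : 0 < q -> q < 1 -> (j <= n)%N ->
  qpoch q q n / q ^+ 'C(n, 2) * (q ^+ 'C(n - j, 2) / qpoch q q (n - j))
  = (-1) ^+ j * q ^+ j * qpoch (q ^- n) q j.
Proof.
move=> q0 q1.
have qn0 : q != 0 by rewrite gt_eqF.
have P0 k : qpoch q q k != 0 by apply: qpoch_neq0 => //; exact: ltW.
elim: j => [_|j IH jn].
  rewrite subn0 /qpoch big_ord0 !mulr1; field.
  by rewrite P0 expf_neq0.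
have := IH (ltnW jn); rewrite qpochS.
have [d nE] : exists d, n = (d + j.+1)%N by exists (n - j.+1)%N; rewrite subnK.
have -> : (n - j)%N = d.+1 by lia.
have -> : (n - j.+1)%N = d by lia.
have -> : q ^- n * q ^+ j = q ^- d.+1.
  by rewrite nE addnS -addSn exprD invfM mulfVK // expf_neq0.
rewrite binS bin1 qpochS => E.
have Q1 : 1 - q * q ^+ d != 0.
  by have := P0 d.+1; rewrite qpochS mulf_eq0 negb_or => /andP[].
transitivity ((-1) ^+ j * q ^+ j * qpoch (q ^- n) q j * ((1 - q * q ^+ d) / q ^+ d)).
  by rewrite -E exprD; field; rewrite !expf_neq0 ?P0 ?Q1.
by rewrite !exprS; field; rewrite !expf_neq0 ?qn0.
Qed.

Lemma little_qjacobi_phi (R : realType) (q al g : R) n N (x : R[i]) :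
  0 < q -> q < 1 -> (n < N)%N ->
  little_qjacobi q al g n x =
  phi_trunc q (q ^- n) (q `^ (al + g + n%:R + 1)) (q `^ (al + 1)) N x.
Proof.
move=> q0 q1 nN.
have qn0 : q != 0 by rewrite gt_eqF.
(* the terms of order above n vanish *)
rewrite /phi_trunc -(subnKC nN) big_split_ord /= [X in _ + X]big1 ?addr0; last first.
  move=> i _; rewrite /phi_coef /= qpoch_qVn_eq0 //; last by lia.
  by rewrite !mul0r.
rewrite /little_qjacobi mulr_sumr [RHS](reindex_inj rev_ord_inj) /=.
apply: eq_bigr => -[k /= kn] _; rewrite subSS.
(* k counts the powers of x from the top; j = n - k is the order of the term *)
set j := (n - k)%N; have jn : (j <= n)%N by rewrite /j; lia.
have -> : k = (n - j)%N by rewrite /j; lia.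
rewrite exprNn !mulrA -[(-1) ^+ j](rmorph_sign (@real_complex R)) -!rmorphM /=; congr (_%:C * _).
have := @qpoch_qVn R q n j q0 q1 jn.
rewrite /phi_coef => E.
transitivity (qpoch q q n / q ^+ 'C(n, 2) * (q ^+ 'C(n - j, 2) / qpoch q q (n - j))
   * (qpoch (q `^ (al + g + n%:R + 1)) q j /
      (qpoch q q j * qpoch (q `^ (al + 1)) q j)) * (-1) ^+ j).
  by rewrite !invfM; ring.
have s2 : (-1) ^+ j * (-1) ^+ j = 1 :> R by rewrite -expr2 sqrr_sign.
rewrite E -[RHS]mulr1 -[X in _ = _ * X]s2; ring.
Qed.

(** With [alpha = beta + m - n] the second parameter [q^(alpha+gamma+n+1)] becomes
    free of [n]: each index then acts on one upper parameter only, which is what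
    turns index shifts into contiguous relations. *)
Lemma qdisk_phi (R : realType) (q beta gamma : R) m n N (z1 z2 : R[i]) :
  0 < q -> q < 1 -> (n <= m)%N -> (n < N)%N ->
  qdisk q beta gamma m n z1 z2 =
  z1 ^+ (m - n) * phi_trunc q (q ^- n) (q `^ (beta + gamma + m%:R + 1))
    (q `^ (beta + m%:R - n%:R + 1)) N (z1 * z2).
Proof.
move=> q0 q1 nm nN; rewrite /qdisk nm /qdisk_ge (@little_qjacobi_phi _ _ _ _ _ N) //.
rewrite natrB //.
have -> : beta + (m%:R - n%:R) + gamma + n%:R + 1 = beta + gamma + m%:R + 1 by ring.
by rewrite [beta + (_ - _)]addrA.
Qed.

Lemma qdisk_n0 (R : realType) (q beta gamma : R) (m : nat) (z1 z2 : R[i]) :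
  0 < q -> q < 1 -> qdisk q beta gamma m 0 z1 z2 = z1 ^+ m.
Proof.
move=> q0 q1; rewrite (@qdisk_phi R q beta gamma m 0 1) // subn0.
by rewrite /phi_trunc big_ord1 phi_coef0 !mulr1.
Qed.

(** * Coefficients of the second recurrence *)

(** The quotient is constant on a punctured neighbourhood of [x], which
    gives the limit, and has the same value at [x] if defined there. *)
Lemma quot_by_continuity_cst (R : realType) (num den : R -> R) (x c : R) :
  (forall y, num y = c * den y) ->
  (\forall y \near x^'%classic, den y != 0) -> quot_by_continuity num den x = c.
Proof.
move=> numE den0; rewrite /quot_by_continuity; case: eqVneq => [_|dx].
  apply: cvg_lim => //.
  apply: (@cvg_trans _ (c @[y --> x^']%classic)); last exact: cvg_cst.
  apply: near_eq_cvg; near=> y.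
  rewrite numE mulfK //; near: y; exact: den0.
by rewrite numE mulfK.
Unshelve. all: by end_near. Qed.

Lemma powR_addn (R : realType) (q x : R) n :
  0 < q -> q `^ (x + n%:R) = q ^+ n * q `^ x.
Proof.
move=> q0; rewrite powRD ?(gt_eqF q0) ?implybT // powR_mulrn ?ltW //.
exact: mulrC.
Qed.

Lemma powR_lt1 (R : realType) (q x : R) :
  0 < q -> q < 1 -> 0 < x -> q `^ x < 1.
Proof.
move=> q0 q1 x0; rewrite /powR gt_eqF // expR_lt1 nmulr_llt0 //.
by rewrite ln_lt0 // q0 q1.
Qed.

Lemma near_dnbhs_neq (R : realType) (x p : R) : \forall y \near x^'%classic, y != p.
Proof.
have [->|xp] := eqVneq p x; first exact: nbhs_dnbhs_neq.
by apply: nbhs_dnbhs; apply: open_nbhs_nbhs; split; [exact: open_neq | rewrite /= eq_sym].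
Qed.

Lemma near_powR_neq1 (R : realType) (q c x : R) : 0 < q -> q < 1 ->
  \forall y \near x^'%classic, 1 - q `^ (c + y) != 0.
Proof.
move=> q0 q1; near=> y.
rewrite subr_eq0 eq_sym powR_eq1 !negb_or lt_eqF // -leNgt ltW //= addrC addr_eq0.
by near: y; exact: near_dnbhs_neq.
Unshelve. all: by end_near. Qed.

Lemma powR_add1 (R : realType) (q x y : R) :
  0 < q -> y = x + 1 -> q `^ y = q * q `^ x.
Proof. by move=> q0 ->; rewrite (@powR_addn _ _ _ 1). Qed.

Lemma qbeta_lt1 (R : realType) (q beta : R) (m n : nat) :
  0 < q -> q < 1 -> -1 < beta -> (n <= m)%N ->
  q `^ (beta + m%:R - n%:R + 1) < 1.
Proof. by move=> q0 q1 b1; rewrite -(ler_nat R) => nm; apply: powR_lt1 => //; lra. Qed.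

(** For [n > 0] the exponent [beta + gamma + m + n + 1] is positive, so no limit
    is taken.  The second factor of [rec_den] is [1 - B / A], whence
    [(1 - C)(A - B) = A * rec_den]; multiplying by it puts the coefficients in the
    form in which they occur in [phi_trunc_upper]. *)
Lemma rec_coefE (R : realType) (q beta gamma : R) (m n : nat) :
  0 < q -> q < 1 -> -1 < beta -> -1 < gamma -> (0 < n <= m)%N ->
  let A := q ^- n in
  let B := q `^ (beta + gamma + m%:R + 1) in
  let C := q `^ (beta + m%:R - n%:R + 1) in
  [/\ (1 - C) * (A - B) != 0,
      (1 - C) * (A - B) * rec_up q beta gamma m n = (A - C) * (1 - B) &
      (1 - C) * (A - B) * rec_down q beta gamma m n = (B - C) * (1 - A)].
Proof.
move=> q0 q1 b1 g1 /andP[n0 nm] A B C.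
have An0 : A != 0 by rewrite invr_neq0 // expf_neq0 // gt_eqF.
have AE : q ^+ n = A^-1 by rewrite invrK.
have D_lt1 : q `^ (beta + gamma + m%:R + n%:R + 1) < 1.
  apply: powR_lt1 => //.
  by move: n0 nm; rewrite -(ler_nat R) -(ler_nat R n); lra.
have DE : q `^ (beta + gamma + m%:R + n%:R + 1) = A^-1 * B.
  by rewrite -AE -powR_addn //; congr (_ `^ _); ring.
have up_numE : q `^ (beta + m%:R + 1) = A^-1 * C.
  by rewrite -AE -powR_addn //; congr (_ `^ _); ring.
have down_numE : q `^ (m%:R - n%:R + beta + 1) = C.
  by congr (_ `^ _); ring.
have BE : B = C * q `^ (gamma + n%:R).
  by rewrite -powRD ?(gt_eqF q0) ?implybT //; congr (_ `^ _); ring.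
have den0 : rec_den q beta m n gamma != 0.
  rewrite mulf_neq0 // subr_eq0 eq_sym lt_eqF //; exact: qbeta_lt1.
have denE : (1 - C) * (A - B) = A * rec_den q beta m n gamma.
  by rewrite /rec_den DE -/C; field.
rewrite denE mulf_neq0 // /rec_up /rec_down /quot_by_continuity (negbTE den0).
have cancel x : A * rec_den q beta m n gamma * (x / rec_den q beta m n gamma) = A * x.
  by field.
rewrite !cancel up_numE -/B down_numE AE; split=> //; first by field.
by rewrite BE; field.
Qed.

(** The numerator and the denominator coincide for [n = 0]; the denominator
    vanishes, as a function of [gamma], at one point at most. *)
Lemma rec_up0 (R : realType) (q beta gamma : R) (m : nat) :
  0 < q -> q < 1 -> -1 < beta -> rec_up q beta gamma m 0 = 1.
Proof.
move=> q0 q1 b1; apply: quot_by_continuity_cst => [y|].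
  by rewrite /rec_den subr0 addr0 mul1r.
near=> y; rewrite mulf_neq0 //.
  by rewrite subr_eq0 eq_sym lt_eqF // qbeta_lt1.
have -> : beta + y + m%:R + 0%:R + 1 = beta + m%:R + 1 + y by ring.
by near: y; exact: near_powR_neq1.
Unshelve. all: by end_near. Qed.

(** * The two recurrences *)

Lemma qdisk_lower (R : realType) (q beta gamma : R) (m n : nat) (z1 z2 : R[i]) :
  0 < q -> q < 1 -> -1 < beta -> (n <= m)%N ->
  ((1 - q `^ (beta + gamma + m%:R + n%:R + 2)) /
     (q ^+ n * (1 - q `^ (beta + m%:R - n%:R + 1))))%:C
    * z2 * qdisk q beta gamma m.+1 n z1 z2
  = - qdisk q beta gamma m.+1 n.+1 z1 z2 + qdisk q beta gamma m n z1 z2.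
Proof.
move=> q0 q1 b1 nm; have qn0 : q != 0 by rewrite gt_eqF.
have C1 := qbeta_lt1 _ _ _ _ _ q0 q1 b1 nm.
rewrite (@qdisk_phi R q beta gamma m n n.+2) //.
rewrite (@qdisk_phi R q beta gamma m.+1 n n.+1) ?(leqW nm) //.
rewrite (@qdisk_phi R q beta gamma m.+1 n.+1 n.+2) // subSS subSn //.
rewrite (@powR_add1 _ q (beta + gamma + m%:R + 1) (beta + gamma + m.+1%:R + 1)) //; last first.
  by rewrite -natr1; ring.
rewrite (@powR_add1 _ q (beta + m%:R - n%:R + 1) (beta + m.+1%:R - n%:R + 1)) //; last first.
  by rewrite -natr1; ring.
have -> : beta + m.+1%:R - n.+1%:R + 1 = beta + m%:R - n%:R + 1.
  by rewrite -!natr1; ring.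
have -> : q `^ (beta + gamma + m%:R + n%:R + 2)
    = q ^+ n.+1 * q `^ (beta + gamma + m%:R + 1).
  by rewrite -powR_addn //; congr (_ `^ _); rewrite -natr1; ring.
move: C1 (powR_ge0 q (beta + m%:R - n%:R + 1)).
set B := q `^ (beta + gamma + _ + 1); set C := q `^ _ => C1 C0.
(* the parameter A of the contiguous relation is q ^- n.+1 *)
have AE : q ^- n = q * q ^- n.+1 by rewrite exprS invfM mulVKf.
rewrite [RHS]addrC -mulrBr AE phi_trunc_lower //.
have -> : (1 - q ^+ n.+1 * B) / (q ^+ n * (1 - C))
    = q * (q ^- n.+1 - B) / (1 - C).
  by rewrite exprS; field; rewrite qn0 expf_neq0 // subr_eq0 eq_sym lt_eqF.
by rewrite [z1 ^+ _.+1]exprS; ring.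
Qed.

Lemma qdisk_upper (R : realType) (q beta gamma : R) (m n : nat) (z1 z2 : R[i]) :
  0 < q -> q < 1 -> -1 < beta -> -1 < gamma -> (n < m)%N ->
  z1 * qdisk q beta gamma m n.+1 z1 z2
  = (rec_up q beta gamma m n.+1)%:C * qdisk q beta gamma m.+1 n.+1 z1 z2
    - (rec_down q beta gamma m n.+1)%:C * qdisk q beta gamma m n z1 z2.
Proof.
move=> q0 q1 b1 g1 nm; have qn0 : q != 0 by rewrite gt_eqF.
have [] := @rec_coefE R q beta gamma m n.+1 q0 q1 b1 g1 nm.
rewrite (@qdisk_phi R q beta gamma m n.+1 n.+2) //.
rewrite (@qdisk_phi R q beta gamma m.+1 n.+1 n.+2) ?(leqW nm) //.
rewrite (@qdisk_phi R q beta gamma m n n.+2) ?(ltnW nm) // subSS -(subnSK nm).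
rewrite (@powR_add1 _ q (beta + gamma + m%:R + 1) (beta + gamma + m.+1%:R + 1)) //; last first.
  by rewrite -natr1; ring.
rewrite (@powR_add1 _ q (beta + m%:R - n.+1%:R + 1) (beta + m.+1%:R - n.+1%:R + 1)) //; last first.
  by rewrite -[m.+1%:R]natr1; ring.
rewrite (@powR_add1 _ q (beta + m%:R - n.+1%:R + 1) (beta + m%:R - n%:R + 1)) //; last first.
  by rewrite -natr1; ring.
have -> : q ^- n = q * q ^- n.+1 by rewrite exprS invfM mulVKf.
move: (qbeta_lt1 _ _ _ _ _ q0 q1 b1 nm) (powR_ge0 q (beta + m%:R - n.+1%:R + 1)).
set A := q ^- n.+1; set B := q `^ (beta + gamma + _ + 1); set C := q `^ _.
move=> C1 C0 K0 upE downE; apply: (mulfI (x := ((1 - C) * (A - B))%:C)).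
  by rewrite fmorph_eq0.
rewrite [RHS]mulrBr 2![_%:C * (_%:C * _)]mulrA -!rmorphM /= upE downE.
have := phi_trunc_upper _ q A B C n.+2 (z1 * z2) q0 q1 C0 C1.
move: (phi_trunc q A B C _ _) => P E.
transitivity (z1 ^+ (m - n.+1).+1 * (((1 - C) * (A - B))%:C * P)).
  by rewrite exprS; ring.
by rewrite E; ring.
Qed.

Theorem theorem6p2 (R : realType) (q beta gamma : R)
    (q_gt0 : 0 < q) (q_lt1 : q < 1) (beta_gt : -1 < beta) (gamma_gt : -1 < gamma)
    (m n : nat) (le_nm : (n <= m)%N) (z1 z2 : R[i]) :
  let M (j k : int) : R[i] := qdisk q beta gamma j k z1 z2 in
  ((1 - q `^ (beta + gamma + m%:R + n%:R + 2)) /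
     (q ^+ n * (1 - q `^ (beta + m%:R - n%:R + 1))))%:C
    * z2 * M (m%:Z + 1) n%:Z
    = - M (m%:Z + 1) (n%:Z + 1) + M m%:Z n%:Z
  /\
  z1 * M m%:Z n%:Z
    = (rec_up q beta gamma m n)%:C * M (m%:Z + 1) n%:Z
      - (rec_down q beta gamma m n)%:C * M m%:Z (n%:Z - 1).
Proof.
move=> M; split; first by rewrite /M -!PoszD !addn1 qdisk_lower.
case: n => [|k] in le_nm *; last first.
  have -> : k.+1%:Z - 1 = k%:Z by rewrite intS addrC addKr.
  by rewrite /M -PoszD addn1 qdisk_upper.
have -> : M m%:Z (0%:Z - 1) = 0 by [].
by rewrite mulr0 subr0 rec_up0 // mul1r /M -PoszD addn1 !qdisk_n0 // exprS.
Qed.
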